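(* There exists a real number $a$ such that the iterated function system $\mathcal{S} = \{S_1, S_2, S_3, S_4, S_5\}$ on $\mathbb{R}$ given by $$S_1(x) = \frac{x}{16}, \quad S_2(x) = \frac{x}{16} + a, \quad S_3(x) = \frac{x}{16} + \frac{15}{16} - 16a, \quad S_4(x) = \frac{x}{16} + \frac{11}{16}, \quad S_5(x) = \frac{x}{16} + \frac{15}{16},$$ with attractor $K$, has all of the following properties: (i) $0, 1 \in K \subset [0,1]$, $K \neq [0,1]$, and $0 < \dim_H(K) < 1$; (ii) the maps $S_1, \dots, S_5$ are pairwise distinct (no exact overlap of level one cylinders), while $S_1 \circ S_5 = S_2 \circ S_3$ (an exact overlap of level two cylinders); (iii) $\mathcal{S}$ satisfies the weak separation property and the finite type condition; (iv) $\mathcal{S}$ satisfies none of the open set condition, the convex open set condition, and the convex finite type condition.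
   Context: Let $\mathcal{S} = \{S_1, \dots, S_n\}$ be maps $S_i : \mathbb{R} \to \mathbb{R}$ of the form $S_i(x) = r x + d_i$ with a common ratio $0 < r < 1$ (an equicontractive iterated function system, IFS). The attractor $K$ is the unique non-empty compact set with $K = \bigcup_{i=1}^n S_i(K)$. $\dim_H$ denotes Hausdorff dimension, and $\mathrm{hull}(K)$ denotes the convex hull of $K$, with $\mathrm{int}$ the topological interior in $\mathbb{R}$. For $k \ge 0$ let $\Sigma^k = \{1, \dots, n\}^k$ and $\Sigma^* = \bigcup_{k \ge 0} \Sigma^k$. For $\sigma = s_1 s_2 \cdots s_k \in \Sigma^k$ write $S_\sigma = S_{s_1} \circ S_{s_2} \circ \cdots \circ S_{s_k}$ (the identity if $k=0$). For $\sigma, \tau \in \Sigma^k$ of the same length, $S_\sigma^{-1} \circ S_\tau(x) = x + a_{\sigma,\tau}$ for a real number $a_{\sigma,\tau}$. Weak separation property (WSP): $\inf \{ |a_{\sigma,\tau}| : k \ge 0,\ \sigma, \tau \in \Sigma^k,\ a_{\sigma,\tau} \ne 0 \} > 0$. Open set condition (OSC): there exists a non-empty open set $V \subset \mathbb{R}$ such that $S_i(V) \subset V$ for all $i$ and $S_i(V) \cap S_j(V) = \emptyset$ for all $i \ne j$. Convex open set condition: the OSC holds with the particular choice $V = \mathrm{int}(\mathrm{hull}(K))$. Finite type condition (FTC): let $V$ be a non-empty open set with $S_i(V) \subset V$ for all $i$. Words $\sigma, \tau \in \Sigma^k$ of the same length are neighbours (with respect to $V$) if $S_\sigma(V) \cap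 S_\tau(V) \ne \emptyset$ (in this case $S_\tau$ is also called a neighbour of $S_\sigma$). The neighbourhood type of $S_\sigma$, for $\sigma \in \Sigma^k$, is $N(S_\sigma) = \{ S_\sigma^{-1} \circ S_\tau : \tau \in \Sigma^k,\ S_\tau \text{ is a neighbour of } S_\sigma \}$. $\mathcal{S}$ satisfies the FTC if there exists such an open set $V$ for which there are only finitely many distinct neighbourhood types $N(S_\sigma)$ as $\sigma$ ranges over $\Sigma^*$. Convex finite type condition: the FTC holds with the particular choice $V = \mathrm{int}(\mathrm{hull}(K))$. *)

(* Defs.v *)
(* MathComp-Analysis; the real line is an arbitrary [R : realType]. *)
From HB Require Import structures.
From mathcomp Require Import all_boot all_order all_algebra.
From mathcomp Require Import all_classical all_reals all_analysis.
From mathcomp Require Import ring lra.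
Set Implicit Arguments.
Unset Strict Implicit.
Unset Printing Implicit Defensive.
Import Order.TTheory GRing.Theory Num.Theory.
Import numFieldNormedType.Exports.
Local Open Scope classical_set_scope.
Local Open Scope ring_scope.

Record ifs (R : realType) (n : nat) := IFS {
  ratio : R;
  translation : 'I_n -> R;
  ratio_gt0 : 0 < ratio;
  ratio_lt1 : ratio < 1 }.

Section IteratedFunctionSystems.
Variables (R : realType) (n : nat) (S : ifs R n).
Implicit Types (sigma tau : seq 'I_n) (V : set R).

Definition ifs_map (i : 'I_n) (x : R) : R := ratio S * x + translation S i.

Definition ifs_map_inv (i : 'I_n) (x : R) : R := (x - translation S i) / ratio S.

(* Words are sequences over ['I_n], and [size] is their length. The first
   letter is the outermost map. *)
Fixpoint word_map sigma : R -> R :=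
  if sigma is i :: sigma' then ifs_map i \o word_map sigma' else id.

Fixpoint word_map_inv sigma : R -> R :=
  if sigma is i :: sigma' then word_map_inv sigma' \o ifs_map_inv i else id.

Lemma ifs_mapK i : cancel (ifs_map i) (ifs_map_inv i).
Proof.
move=> x; rewrite /ifs_map_inv /ifs_map addrK mulrAC divff ?mul1r ?gt_eqF ?ratio_gt0 //.
Qed.

Lemma ifs_map_invK i : cancel (ifs_map_inv i) (ifs_map i).
Proof.
by move=> x; rewrite /ifs_map_inv /ifs_map mulrC divfK ?subrK ?gt_eqF ?ratio_gt0.
Qed.

Lemma word_mapK sigma : cancel (word_map sigma) (word_map_inv sigma).
Proof. by elim: sigma => //= i s IH x /=; rewrite ifs_mapK IH. Qed.

Lemma word_map_invK sigma : cancel (word_map_inv sigma) (word_map sigma).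
Proof. by elim: sigma => //= i s IH x /=; rewrite IH ifs_map_invK. Qed.

(* Chosen by [get]: for n > 0 exactly one set satisfies this predicate. *)
Definition attractor : set R :=
  get [set K : set R | [/\ K !=set0, compact K
                         & K = \bigcup_(i in [set: 'I_n]) (ifs_map i @` K)]].

Definition relative_translations : set R :=
  [set a | exists sigma tau, size sigma = size tau /\
     forall x, word_map_inv sigma (word_map tau x) = x + a].

(* The infimum is taken in the extended reals, so that it is [+oo], rather than
   a default value, when there is no nonzero relative translation. *)
Definition weak_separation_property : Prop :=
  (0 < ereal_inf
         [set `|a|%R%:E | a in [set a : R | relative_translations a /\ a != 0%R]])%E.

Definition open_set_condition_for V : Prop :=
  [/\ V !=set0, open V, forall i, ifs_map i @` V `<=` V
    & forall i j, i != j -> (ifs_map i @` V) `&` (ifs_map j @` V) = set0].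

Definition open_set_condition : Prop := exists V, open_set_condition_for V.

Definition convex_hull (A : set R) : set R := smallest (@convex_set R R^o) A.

Definition convex_open_set_condition : Prop :=
  open_set_condition_for (interior (convex_hull attractor)).

Definition neighbours V sigma tau : Prop :=
  size sigma = size tau /\
  (word_map sigma @` V) `&` (word_map tau @` V) !=set0.

Definition neighbourhood_type V sigma : set (R -> R) :=
  [set word_map_inv sigma \o word_map tau | tau in neighbours V sigma].

Definition finite_type_condition_for V : Prop :=
  [/\ V !=set0, open V, forall i, ifs_map i @` V `<=` V
    & finite_set [set neighbourhood_type V sigma | sigma in [set: seq 'I_n]]].

Definition finite_type_condition : Prop := exists V, finite_type_condition_for V.

Definition convex_finite_type_condition : Prop :=
  finite_type_condition_for (interior (convex_hull attractor)).

End IteratedFunctionSystems.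

Section HausdorffDimension.
Variable R : realType.
Implicit Types (s delta : R) (A U : set R).
Local Open Scope ereal_scope.

(* [-oo] on the empty set *)
Definition diameter A : \bar R := ereal_sup [set `|x - y|%R%:E | x in A & y in A].

(* The empty set has to contribute 0 to every cover; for s = 0 the bare power
   would be 1. *)
Definition diameter_pow s U : \bar R :=
  if U == set0 then 0 else diameter U `^ s.

Definition hausdorff_premeasure s delta A : \bar R :=
  ereal_inf [set \sum_(0 <= i <oo) diameter_pow s (U i) | U in
    [set U : nat -> set R |
       A `<=` \bigcup_i U i /\ forall i, diameter (U i) <= delta%:E]].

Definition hausdorff_measure s A : \bar R :=
  ereal_sup [set hausdorff_premeasure s delta A | delta in
    [set delta | (0 < delta)%R]].

Definition hausdorff_dimension A : \bar R :=
  ereal_inf [set s%:E | s in [set s | (0 <= s)%R /\ hausdorff_measure s A = 0]].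

End HausdorffDimension.

Section Example.
Variables (R : realType) (a : R).

Lemma example_ratio_gt0 : 0 < 1 / 16 :> R. Proof. lra. Qed.
Lemma example_ratio_lt1 : 1 / 16 < 1 :> R. Proof. lra. Qed.

Definition example_translation (i : 'I_5) : R :=
  nth 0 [:: 0; a; 15 / 16 - 16 * a; 11 / 16; 15 / 16] i.

Definition example_ifs : ifs R 5 :=
  IFS example_translation example_ratio_gt0 example_ratio_lt1.

(* The maps S_1, ..., S_5 have the indices 0, ..., 4. *)
Lemma example_ifs_mapE (x : R) :
  [/\ ifs_map example_ifs (inord 0) x = x / 16,
      ifs_map example_ifs (inord 1) x = x / 16 + a,
      ifs_map example_ifs (inord 2) x = x / 16 + 15 / 16 - 16 * a,
      ifs_map example_ifs (inord 3) x = x / 16 + 11 / 16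
    & ifs_map example_ifs (inord 4) x = x / 16 + 15 / 16].
Proof.
by split; rewrite /ifs_map /= /example_translation inordK //=; field.
Qed.

End Example.

(* Main.v *)
(** Put t = 16 a. A relative translation b of a pair of words becomes
    16 (b + d_j - d_i) when the letters i, j are appended, and it has modulus at
    least 1 for ever once it has left (-1, 1). Choose t with hexadecimal
    expansion 0.BF..., all later digits being 4 or F in an aperiodic pattern, and
    let x_k be the number obtained from t by dropping its first k digits (so
    x_0 = t). Then the only transitions staying in (-1, 1) are, up to sign,
    0 -> 0, 0 -> t, t -> 0 (the exact overlap) and x_k -> x_(k+1), with
    x_k >= 4/15: this is the weak separation property. Aperiodicity makes the
    x_k distinct, and they all lie in (0, 1), which refutes the convex finite
    type condition. The union V of all the images of the interval (3/4, 7/8) is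
    disjoint from V + x_k for k >= 1, so that only the translations 0 and ±t
    occur between neighbours with respect to V. *)

Require Import Defs.
From mathcomp Require Import all_boot all_order all_algebra.
From mathcomp Require Import all_classical all_reals all_analysis.
From mathcomp Require Import ring lra zify.
Set Implicit Arguments.
Unset Strict Implicit.
Unset Printing Implicit Defensive.
Import Order.TTheory GRing.Theory Num.Theory.
Import numFieldNormedType.Exports.
Local Open Scope classical_set_scope.
Local Open Scope ring_scope.

(** * Real numbers given by sequences of hexadecimal digits *)

Section HexadecimalExpansions.
Variable R : realType.
Implicit Types (c : nat -> R) (a b d m M : R).

(** Letting n grow removes the error term. This serves for estimates proved by comparing finitely
    many digits. *)
Lemma le_add_geometric a b d :
  (forall n : nat, a <= b + d * (1 / 16) ^+ n) -> a <= b.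
Proof.
move=> h.
have cv : (fun n => b + d * (1 / 16 : R) ^+ n) @ \oo --> b.
  rewrite -[X in _ --> X]addr0; apply: cvgD; first exact: cvg_cst.
  rewrite -[X in _ --> X](mulr0 d); apply: cvgM; first exact: cvg_cst.
  by apply: cvg_expr; rewrite ger0_norm; lra.
rewrite -(cvg_lim (@Rhausdorff R) cv); apply: limr_ge.
  by apply/cvg_ex; exists b.
by near=> n; exact: h.
Unshelve. all: end_near. Qed.

Definition expansion c : R := limn (series (fun n => c n / 16 ^+ n.+1)).

Definition digit_shift c k : nat -> R := fun n => c (k + n)%N.

(** The bounds are the partial sums for the constant digits m and M. *)
Lemma series_digits_bounds c m M n : (forall n, m <= c n <= M) ->
  m / 15 * (1 - (1 / 16) ^+ n) <= series (fun n => c n / 16 ^+ n.+1) n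
    <= M / 15 * (1 - (1 / 16) ^+ n).
Proof.
move=> hc; elim: n => [|n /andP[ihl ihr]].
  by rewrite /series /= big_geq // expr0 subrr !mulr0 lexx.
rewrite seriesSr /= exprS.
have /andP[h1 h2] := hc n.
have -> : c n / 16 ^+ n.+1 = c n * (1 / 16) ^+ n / 16 :> R.
  by rewrite exprS expr_div_n expr1n; field; rewrite expf_neq0 //; lra.
set q := (1 / 16) ^+ n in ihl ihr *; have q0 : 0 <= q by apply: exprn_ge0; lra.
have : m * q <= c n * q by rewrite ler_wpM2r.
have : c n * q <= M * q by rewrite ler_wpM2r.
by move=> *; apply/andP; split; lra.
Qed.

Lemma is_cvg_digits c : (forall n, 0 <= c n <= 15) ->
  cvgn (series (fun n => c n / 16 ^+ n.+1)).
Proof.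
move=> hc; apply: nondecreasing_is_cvgn.
  apply/nondecreasing_seqP => n; rewrite seriesSr /= lerDl.
  by rewrite divr_ge0 ?exprn_ge0 //; case/andP: (hc n).
exists 1 => _ [n _ <-].
have /andP[_] := series_digits_bounds n hc.
have : 0 <= (1 / 16) ^+ n :> R by apply: exprn_ge0; lra.
by move=> *; lra.
Qed.

Lemma expansion_bounds c m M : 0 <= m -> M <= 15 ->
  (forall n, m <= c n <= M) -> m / 15 <= expansion c <= M / 15.
Proof.
move=> m0 M15 hc.
have hc' n : 0 <= c n <= 15.
  by have /andP[? ?] := hc n; apply/andP; split; lra.
have cv := is_cvg_digits hc'.
have q0 n : 0 <= (1 / 16) ^+ n :> R by apply: exprn_ge0; lra.
apply/andP; split.
  apply: (@le_add_geometric _ _ (m / 15)) => n.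
  have nd : {homo series (fun n => c n / 16 ^+ n.+1) : n m / (n <= m)%N >-> n <= m}.
    apply/nondecreasing_seqP => k; rewrite seriesSr /= lerDl.
    by rewrite divr_ge0 ?exprn_ge0 //; case/andP: (hc' k).
  have := nondecreasing_cvgn_le nd cv n; rewrite -/(expansion c).
  have /andP[+ _] := series_digits_bounds n hc.
  by lra.
apply: limr_le => //; near=> n.
have /andP[_] := series_digits_bounds n hc.
have M0 : 0 <= M by have /andP[? ?] := hc 0%N; lra.
have : 0 <= M * (1 / 16) ^+ n by rewrite mulr_ge0.
by rewrite -(mulrA M); lra.
Unshelve. all: end_near. Qed.

Lemma expansion_recl c : (forall n, 0 <= c n <= 15) ->
  expansion c = (c 0%N + expansion (digit_shift c 1)) / 16.
Proof.
move=> hc; rewrite /expansion.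
have hc' n : 0 <= digit_shift c 1 n <= 15 by exact: hc.
have cv := is_cvg_digits hc'.
apply/cvg_lim => //; rewrite -(cvg_shiftS _).
have -> : [sequence series (fun n => c n / 16 ^+ n.+1) n.+1]_n =
    fun n => (c 0%N + series (fun n => digit_shift c 1 n / 16 ^+ n.+1) n) / 16.
  apply/funext => n; rewrite /series /= big_nat_recl // expr1 mulrDl; congr (_ + _).
  rewrite mulr_suml; apply: eq_bigr => i _; rewrite /digit_shift add1n.
  by rewrite [16 ^+ i.+2]exprSr invfM mulrA.
apply: cvgM; last exact: cvg_cst.
by apply: cvgD; first exact: cvg_cst.
Qed.

End HexadecimalExpansions.

(** * An aperiodic digit sequence and its tails x_k *)

Section AperiodicDigits.

Definition is_pow2 (n : nat) : bool := (2 ^ trunc_log 2 n == n)%N.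

Lemma is_pow2_exp m : is_pow2 (2 ^ m)%N.
Proof. by rewrite /is_pow2 trunc_expnK. Qed.

(** Once p < 2^n, the number 2^n + p lies strictly between 2^n and 2^(n+1). The choice N = p ensures
    p < 2^n. *)
Lemma is_pow2_not_periodic p : (0 < p)%N ->
  exists N, forall n, (N <= n)%N -> exists2 i, (n <= i)%N & is_pow2 i && ~~ is_pow2 (i + p)%N.
Proof.
move=> p0; exists p => n pn; exists (2 ^ n)%N; first exact: ltnW (ltn_expl _ _).
rewrite is_pow2_exp /= /is_pow2.
have pl : (p < 2 ^ n)%N by apply: leq_ltn_trans pn (ltn_expl _ _).
have -> : trunc_log 2 (2 ^ n + p)%N = n.
  by apply: trunc_log_eq => //; rewrite leq_addr /= expnS mul2n -addnn ltn_add2l.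
by apply/negP => /eqP; lia.
Qed.

Variable R : realType.

(** The values 11, 15 and 4 are 16 times differences of the translations 0, 11/16 and 15/16, so that
    pairs of letters can realise them. *)
Definition hexdigit (k : nat) : R :=
  if k == 0%N then 11 else if is_pow2 k then 15 else 4.

Lemma hexdigit_bounds k : 4 <= hexdigit k <= 15.
Proof. by rewrite /hexdigit; case: ifP => _; [|case: ifP => _]; apply/andP; split; lra. Qed.

Definition hextail (k : nat) : R := expansion (digit_shift hexdigit k).

Lemma hextail_recl k : hextail k = (hexdigit k + hextail k.+1) / 16.
Proof.
rewrite /hextail expansion_recl /digit_shift ?addn0.
  by congr ((_ + expansion _) / _); apply/funext => n; rewrite addnA addn1.
by move=> n; have /andP[? ?] := hexdigit_bounds (k + n); apply/andP; split; lra.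
Qed.

Lemma hextail_ge k : 4 / 15 <= hextail k.
Proof.
suff /andP[] : 4 / 15 <= hextail k <= 15 / 15 by [].
by apply: expansion_bounds => [||n]; [lra|lra|exact: hexdigit_bounds].
Qed.

Lemma hextail_le1 k : hextail k <= 1.
Proof.
suff /andP[_] : 4 / 15 <= hextail k <= 15 / 15 by lra.
by apply: expansion_bounds => [||n]; [lra|lra|exact: hexdigit_bounds].
Qed.

Lemma hexdigit_pos k : hexdigit k.+1 = 15 \/ hexdigit k.+1 = 4.
Proof. by rewrite /hexdigit /=; case: ifP => _; [left|right]. Qed.

(** According to the leading digit, 16 x_(k+1) lies in [4 + 4/15, 5] or in [15 + 4/15, 16], and
    these are disjoint. *)
Lemma hexdigit_eq k l : hextail k.+1 = hextail l.+1 -> hexdigit k.+1 = hexdigit l.+1.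
Proof.
have := hextail_recl k.+1; have := hextail_recl l.+1.
have := hextail_ge k.+2; have := hextail_ge l.+2.
have := hextail_le1 k.+2; have := hextail_le1 l.+2.
by case: (hexdigit_pos k) => ->; case: (hexdigit_pos l) => -> *; lra.
Qed.

Lemma hextail_eq_addl k l i : hextail k.+1 = hextail l.+1 ->
  hextail (i + k)%N.+1 = hextail (i + l)%N.+1.
Proof.
move=> kl; elim: i => // i IH; rewrite !addSn.
have := hexdigit_eq IH; have := hextail_recl (i + k)%N.+1.
by have := hextail_recl (i + l)%N.+1; lra.
Qed.

(** A coincidence of tails would make the digits periodic with period l - k from index k+1 on, but
    the powers of two have no eventual period. *)
Lemma hextailS_inj : injective (fun k => hextail k.+1).
Proof.
suff nlt k l : (k < l)%N -> hextail k.+1 <> hextail l.+1.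
  by move=> k l /= kl; case: (ltngtP k l) => // /nlt; rewrite kl.
move=> kl e.
have [N hN] := @is_pow2_not_periodic (l - k)%N ltac:(by rewrite subn_gt0).
(* Adding [k.+1] places the power of two [i] inside the common tail. *)
have [i ni /andP[i1 i2]] := hN (N + k.+1)%N (leq_addr _ _).
have ik : (k.+1 <= i)%N by apply: leq_trans ni; rewrite leq_addl.
have := hexdigit_eq (hextail_eq_addl (i - k.+1)%N e).
have -> : (i - k.+1 + k)%N.+1 = i by lia.
have -> : (i - k.+1 + l)%N.+1 = (i + (l - k))%N by lia.
rewrite /hexdigit (negbTE i2) i1 !gtn_eqF ?addn_gt0 ?(leq_trans _ ik) //.
by lra.
Qed.

(** The value 1 would force the digit 15 and the value 1 for the next tail as well, against
    injectivity. *)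
Lemma hextail_lt1 k : hextail k.+1 < 1.
Proof.
rewrite lt_neqAle hextail_le1 andbT; apply/eqP => e.
have := hextail_recl k.+1; have := hextail_le1 k.+2.
case: (hexdigit_pos k) => -> *; last by lra.
suff /hextailS_inj : hextail k.+1 = hextail k.+2 by lia.
by lra.
Qed.

Lemma hexdigit0 : hexdigit 0 = 11. Proof. by []. Qed.

Lemma hexdigit1 : hexdigit 1 = 15. Proof. by rewrite /hexdigit -[1%N]/(2 ^ 0)%N is_pow2_exp. Qed.

End AperiodicDigits.

(** * Open sets, neighbourhood types and convex hulls for a general system *)

Section GeneralIFS.
Variables (R : realType) (n : nat) (S : ifs R n).
Implicit Types (sigma tau : seq 'I_n) (A V : set R).

Lemma word_map_rcons sigma i x :
  word_map S (rcons sigma i) x = word_map S sigma (ifs_map S i x).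
Proof. by elim: sigma => //= j sigma ->. Qed.

Lemma word_map_inj sigma : injective (word_map S sigma).
Proof. exact: can_inj (word_mapK S sigma). Qed.

(** For x in V the point S_i(S_k(x)) = S_j(S_l(x)) lies in both S_i(V) and S_j(V), since S_k and S_l
    map V into itself. *)
Lemma overlap_not_open_set_condition_for V i j k l : i != j ->
  ifs_map S i \o ifs_map S k = ifs_map S j \o ifs_map S l ->
  ~ open_set_condition_for S V.
Proof.
move=> ij e [[x Vx] _ SV dis].
suff : (ifs_map S i @` V `&` ifs_map S j @` V) (ifs_map S i (ifs_map S k x)).
  by rewrite dis.
split; first by exists (ifs_map S k x) => //; apply: (SV k); exists x.
by rewrite -/((_ \o _) x) e; exists (ifs_map S l x) => //; apply: (SV l); exists x.
Qed.

(** Neighbours have the same length, and there are finitely many words of each length. *)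
Lemma neighbourhood_type_finite V sigma :
  finite_set (neighbourhood_type S V sigma).
Proof.
apply: finite_image; apply: (@sub_finite_set _ _
  ((fun t : (size sigma).-tuple 'I_n => tval t) @` setT)).
  by move=> tau [st _]; exists (tcast (esym st) (in_tuple tau)) => //; rewrite val_tcast.
exact/finite_image/finite_finset.
Qed.

Lemma unit_interval_sub_hull A : A 0 -> A 1 ->
  `]0, 1[%classic `<=` interior (convex_hull A).
Proof.
move=> A0 A1; rewrite -open_subsetE; last exact: interval_open.
move=> y /=; rewrite in_itv /= => /andP[y0 y1] B [cB AB].
have := cB 1 0 (Itv01 (ltW y0) (ltW y1)); rewrite !inE => /(_ (AB _ A1) (AB _ A0)).
by congr B; rewrite -[LHS]/(conv (Itv01 (ltW y0) (ltW y1)) (1 : R^o) (0 : R^o))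
  convRE /= mulr1 mulr0 addr0.
Qed.

End GeneralIFS.

(** * Existence of the attractor as a decreasing intersection *)

Section AttractorExistence.
Variables (R : realType) (n : nat) (S : ifs R n) (u v : R).
Hypothesis stable : forall i x, u <= x <= v -> u <= ifs_map S i x <= v.

Fixpoint attractor_approx m : set R :=
  if m is m'.+1 then \bigcup_(i in [set: 'I_n]) (ifs_map S i @` attractor_approx m')
  else `[u, v]%classic.

Lemma attractor_approxS m : attractor_approx m.+1 `<=` attractor_approx m.
Proof.
elim: m => [|m IH] x [i _ [y hy <-]].
  by move: hy => /=; rewrite !in_itv /=; exact: stable.
by exists i => //; exists y => //; exact: IH.
Qed.

Lemma attractor_approx_le l m : (l <= m)%N -> attractor_approx m `<=` attractor_approx l.
Proof.
move/subnK <-; elim: (m - l)%N => //= k IH.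
exact: subset_trans (@attractor_approxS _) IH.
Qed.

Lemma continuous_ifs_map_inv i : continuous (ifs_map_inv S i).
Proof.
move=> x; rewrite /ifs_map_inv; apply: cvgM; last exact: cvg_cst.
by apply: cvgB; [exact: cvg_id | exact: cvg_cst].
Qed.

Lemma closed_attractor_approx m : closed (attractor_approx m).
Proof.
elim: m => [|m IH]; first exact: interval_closed.
apply: closed_bigcup => [|i _]; first exact: finite_finset.
have -> : ifs_map S i @` attractor_approx m = ifs_map_inv S i @^-1` attractor_approx m.
  apply/seteqP; split => [_ [x hx <-]|x hx] /=; first by rewrite ifs_mapK.
  by exists (ifs_map_inv S i x); rewrite ?ifs_map_invK.
by apply: closed_comp => // x _; exact: continuous_ifs_map_inv.
Qed.

(** The intersection of the approximations is compact and invariant. The fixed point survives in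
    every approximation, which makes the intersection non-empty. *)
Lemma attractorP : (exists i x, u <= x <= v /\ ifs_map S i x = x) ->
  [/\ attractor S !=set0, compact (attractor S)
    & attractor S = \bigcup_(i in [set: 'I_n]) (ifs_map S i @` attractor S)].
Proof.
move=> [i0 [x0 [hx0 fx0]]].
suff /getPex : exists K : set R, [set K : set R | [/\ K !=set0, compact K
  & K = \bigcup_(i in [set: 'I_n]) (ifs_map S i @` K)]] K by [].
exists (\bigcap_m attractor_approx m); split.
- exists x0 => m _; elim: m => [|m IH] /=; first by rewrite in_itv.
  by exists i0 => //; exists x0.
- apply: (@subclosed_compact _ _ `[u, v]%classic).
  + by apply: closed_bigI => m _; exact: closed_attractor_approx.
  + exact: segment_compact.
  + by move=> x hx; exact: (hx 0%N).
- apply/seteqP; split => [x hx|x [i _ [y hy <-]] m _]; last first.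
    by apply: attractor_approxS; exists i => //; exists y => //; exact: hy.
  suff [i hi] : exists i, forall m, attractor_approx m (ifs_map_inv S i x).
    by exists i => //; exists (ifs_map_inv S i x); [move=> m _; exact: hi|rewrite ifs_map_invK].
  (* Otherwise the preimage under each letter [i] leaves the approximations at some stage [N i]. By
     monotonicity all of them are out at the maximal stage, although [x] lies in the stage after
     it. *)
  apply: contrapT => /forallNP no.
  have /choice[N hN] : forall i, exists m, ~ attractor_approx m (ifs_map_inv S i x).
    by move=> i; apply/existsNP; exact: no.
  have [i _ [y hy yx]] := hx (\max_i N i).+1 I.
  apply: (hN i); rewrite -yx ifs_mapK.
  exact: attractor_approx_le (leq_bigmax i) _ hy.
Qed.

End AttractorExistence.

(** * Upper and lower bounds for the Hausdorff dimension *)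

Section HausdorffDimensionBounds.
Variable R : realType.
Implicit Types (s delta rho : R) (A U : set R).

Lemma diameter_pow_ge0 s U : (0 <= diameter_pow s U)%E.
Proof. by rewrite /diameter_pow; case: ifP => // _; exact: poweR_ge0. Qed.

Lemma diameter_ge0 U : U !=set0 -> (0 <= diameter U)%E.
Proof.
by move=> [x Ux]; apply: ereal_sup_ubound; exists x => //; exists x => //; rewrite subrr normr0.
Qed.

(** This value lets empty sets meet every bound on diameters, so that a finite cover can be padded
    to a sequence. *)
Lemma diameter_set0 : diameter (set0 : set R) = -oo%E.
Proof.
rewrite /diameter; set E := (X in ereal_sup X).
suff -> : E = set0 by rewrite ereal_sup0.
by apply/seteqP; split => // z [].
Qed.

Lemma diameter_pow_le s U (b : R) : 0 <= s -> 0 <= b ->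
  (diameter U <= b%:E)%E -> (diameter_pow s U <= (b `^ s)%:E)%E.
Proof.
move=> s0 b0 Ub; rewrite /diameter_pow; case: ifPn => [_|/set0P U0].
  by rewrite lee_fin powR_ge0.
rewrite -poweR_EFin; apply: gt0_ler_poweR => //; rewrite in_itv /= leey andbT.
  exact: diameter_ge0.
by rewrite lee_fin.
Qed.

Lemma hausdorff_premeasure_ge0 s delta A : (0 <= hausdorff_premeasure s delta A)%E.
Proof.
apply: le_ereal_inf_tmp => _ [U _ <-].
by apply: nneseries_ge0 => i _ _; exact: diameter_pow_ge0.
Qed.

Lemma expr_small (q e : R) : 0 <= q < 1 -> 0 < e -> \forall m \near \oo, q ^+ m < e.
Proof.
move=> /andP[q0 q1] e0.
have /cvgr0_norm_lt/(_ _ e0) : (fun m => q ^+ m) @ \oo --> (0 : R).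
  by apply: cvg_expr; rewrite ger0_norm.
by apply: filterS => m; rewrite ger0_norm // exprn_ge0.
Qed.

Lemma hausdorff_premeasure_le s delta rho A (N m : nat) (U : nat -> set R) :
  0 <= s -> 0 < rho -> rho ^+ m <= delta -> A `<=` \bigcup_(i in `I_(N ^ m)%N) U i ->
  (forall i, (diameter (U i) <= (rho ^+ m)%:E)%E) ->
  (hausdorff_premeasure s delta A <= ((N%:R * rho `^ s) ^+ m)%:E)%E.
Proof.
move=> s0 r0 md AU dU.
pose W i := if (i < N ^ m)%N then U i else set0.
have dW i : (diameter (W i) <= (rho ^+ m)%:E)%E.
  by rewrite /W; case: ifP => // _; rewrite diameter_set0 leNye.
apply: ge_ereal_inf; exists (\sum_(0 <= i <oo) diameter_pow s (W i))%E.
  exists W => //; split=> [x /AU[i /= iN Ux]|i].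
    by exists i => //; rewrite /W iN.
  by apply: le_trans (dW i) _; rewrite lee_fin.
rewrite (nneseries_split 0 (N ^ m)%N); last by move=> k _; exact: diameter_pow_ge0.
rewrite add0n [X in (_ + X)%E]eseries0 ?adde0; last first.
  by move=> i Ni _; rewrite /W ltnNge Ni /= /diameter_pow eqxx.
apply: (@le_trans _ _ (\sum_(0 <= i < (N ^ m)%N) ((rho ^+ m) `^ s)%:E)%E).
  by apply: lee_sum => i _; apply: diameter_pow_le => //; rewrite exprn_ge0 // ltW.
rewrite sumEFin lee_fin sumr_const_nat subn0 exprMn -[_ *+ _]mulr_natl natrX.
suff -> : (rho ^+ m) `^ s = (rho `^ s) ^+ m by [].
by rewrite -(powR_mulrn m (ltW r0)) -(powR_mulrn m (powR_ge0 _ _)) -!powRrM mulrC.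
Qed.

(** Both the mesh rho^m of the covers and their s-sums, at most (N rho^s)^m, tend to 0, so the
    s-dimensional measure vanishes. *)
Lemma hausdorff_dimension_le s rho A (N : nat) : 0 <= s -> 0 < rho < 1 ->
  N%:R * rho `^ s < 1 ->
  (forall m, exists U : nat -> set R, A `<=` \bigcup_(i in `I_(N ^ m)%N) U i /\
     forall i, (diameter (U i) <= (rho ^+ m)%:E)%E) ->
  (hausdorff_dimension A <= s%:E)%E.
Proof.
move=> s0 /andP[r0 r1] q1 cover; apply: ereal_inf_lbound; exists s => //; split=> //.
have q0 : 0 <= N%:R * rho `^ s by rewrite mulr_ge0 ?powR_ge0.
apply/eqP; rewrite eq_le; apply/andP; split; last first.
  by apply: le_ereal_sup_tmp; exists (hausdorff_premeasure s 1 A);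
    [exists 1 => //=; lra | exact: hausdorff_premeasure_ge0].
apply: ge_ereal_sup => _ [delta /= delta0 <-].
apply/lee_addgt0Pr => e e0; rewrite add0e.
have [m [/ltW md /ltW me]] : exists m, rho ^+ m < delta /\ (N%:R * rho `^ s) ^+ m < e.
  near \oo => m; exists m; split; near: m; apply: expr_small => //.
    by rewrite ltW.
  by rewrite q0.
have [U [AU dU]] := cover m.
by apply: le_trans (hausdorff_premeasure_le s0 r0 md AU dU) _; rewrite lee_fin.
Unshelve. all: end_near. Qed.

(* A (1/p)-Hölder inverse of g pulls a cover of A back to a cover of [0, 1],
   whose total length is at least 1. *)
Lemma hausdorff_dimension_ge A (g : R -> R) (p : nat) (C : R) : 0 < C ->
  (forall y : R, 0 <= y <= 1 -> A (g y)) ->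
  (forall y z : R, 0 <= y <= 1 -> 0 <= z <= 1 ->
     `|y - z| ^+ p.+1 <= C * `|g y - g z|) ->
  ((p.+1%:R^-1)%:E <= hausdorff_dimension A)%E.
Proof.
move=> C0 Ag holder; apply: le_ereal_inf_tmp => _ [s [s0 As] <-].
rewrite lee_fin leNgt; apply/negP => sp; pose c := C `^ p.+1%:R^-1.
have c0 : 0 < c by rewrite powR_gt0.
(* The premeasure at scale 1 is at most the measure, which is 0, so a positive lower bound is a
   contradiction. *)
suff : ((2 * c)^-1%:E <= hausdorff_premeasure s 1 A)%E.
  apply/negP; rewrite -ltNge; apply: (@le_lt_trans _ _ 0%E).
    by rewrite -As; apply: ereal_sup_ubound; exists 1 => //=; lra.
  by rewrite lte_fin invr_gt0; lra.
apply: le_ereal_inf_tmp => _ [U [AU dU] <-].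
have /choice[J hJ] : forall i, exists J : set R, [/\ measurable J,
    forall y, 0 <= y <= 1 -> U i (g y) -> J y
  & (lebesgue_measure J <= (2 * c)%:E * diameter_pow s (U i))%E].
  move=> i; have [[y [hy Uy]]|no] := pselect (exists y, 0 <= y <= 1 /\ U i (g y)); last first.
    exists set0; split=> //; first by move=> y hy Uy; apply: no; exists y.
    by rewrite measure0 mule_ge0 ?diameter_pow_ge0 // lee_fin; lra.
  have U0 : U i !=set0 by exists (g y).
  have fd : diameter (U i) \is a fin_num.
    by rewrite ge0_fin_numE ?diameter_ge0 //; exact: le_lt_trans (dU i) (ltry _).
  pose D := fine (diameter (U i)).
  have DE : diameter (U i) = D%:E by rewrite fineK.
  have D0 : 0 <= D by rewrite -lee_fin -DE diameter_ge0.
  have D1 : D <= 1 by rewrite -lee_fin -DE.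
  have -> : diameter_pow s (U i) = (D `^ s)%:E.
    by rewrite /diameter_pow ifF ?DE //; apply/eqP/eqP/set0P.
  (* The Hölder inequality gives |y - z| <= c D^(1/(p+1)), and this is at most c D^s because D <= 1
     and s < 1/(p+1). *)
  exists `[y - c * D `^ s, y + c * D `^ s]%classic; split.
  - exact: measurable_itv.
  - move=> z hz Uz.
    have : `|y - z| <= c * D `^ s.
      have -> : `|y - z| = (`|y - z| ^+ p.+1) `^ p.+1%:R^-1.
        by rewrite -powR_mulrn // -powRrM divff ?pnatr_eq0 // powRr1.
      apply: (@le_trans _ _ ((C * D) `^ p.+1%:R^-1)).
        apply: ge0_ler_powR; rewrite ?nnegrE ?invr_ge0 ?exprn_ge0 ?mulr_ge0 ?(ltW C0) //.
        apply: le_trans (holder _ _ hy hz) _; rewrite ler_pM2l // -lee_fin -DE.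
        by apply: ereal_sup_ubound; exists (g y) => //; exists (g z).
      rewrite powRM ?(ltW C0) // ler_pM2l //.
      have [->|Dn0] := eqVneq D 0; first by rewrite powR0 ?powR_ge0 // invr_eq0 pnatr_eq0.
      by apply: ger_powR; rewrite ?lt_neqAle 1?eq_sym ?Dn0 ?D0 // ltW.
    by rewrite /= in_itv /= ler_norml => /andP[? ?]; apply/andP; split; lra.
  - have : 0 <= c * D `^ s by rewrite mulr_ge0 ?powR_ge0 // ltW.
    rewrite lebesgue_measure_itv /= -EFinM => h; case: ifP => _.
      by rewrite -EFinB lee_fin; lra.
    by rewrite lee_fin; lra.
have : (lebesgue_measure (`[0%R, 1%R]%classic : set R)
    <= \sum_(0 <= i <oo) lebesgue_measure (J i))%E.
  apply: measure_sigma_subadditive => [i||]; [by case: (hJ i)|exact: measurable_itv|].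
  move=> y /=; rewrite in_itv /= => hy; have [i _ Ui] := AU _ (Ag _ hy).
  by exists i => //; case: (hJ i) => _ + _; apply.
rewrite lebesgue_measure_itv /= lte01 sube0 => h.
rewrite -(@lee_pmul2l _ (2 * c)%:E) ?fin_numE //; last by rewrite lte_fin; lra.
rewrite -EFinM divff; last by apply/eqP; lra.
rewrite -nneseriesZl; last by move=> *; exact: diameter_pow_ge0.
apply: le_trans h _; apply: lee_nneseries => [i _ _|i _]; first exact: measure_ge0.
by case: (hJ i).
Qed.

End HausdorffDimensionBounds.

(** * Transitions between relative translations, and weak separation *)

Section Counterexample.
Variable R : realType.

Notation x_ := (hextail R).
Notation a := (x_ 0 / 16).
Notation S := (example_ifs a).
Notation d := (example_translation a).
Implicit Types (b : R) (sigma tau : seq 'I_5) (i j : 'I_5).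

Lemma example_mapE i x : ifs_map S i x = x / 16 + d i.
Proof. by rewrite /ifs_map /= mulrC mulrA mulr1. Qed.

Definition close_translation b : Prop := b = 0 \/ exists k, b = x_ k \/ b = - x_ k.

(** The two known leading digits express x_0 and x_1 through x_2 in [4/15, 1], which makes the case
    checks over letters linear arithmetic. *)
Lemma hextail01E : x_ 0 = (11 + x_ 1) / 16 /\ x_ 1 = (15 + x_ 2) / 16.
Proof. by rewrite -hexdigit0 -(hexdigit1 R) -!hextail_recl. Qed.

(** All 25 pairs of letters are checked. The outcome x_(k+1) arises when d_i - d_j is the leading
    digit of x_k over 16. *)
Lemma hextail_step k i j : let b := 16 * (x_ k + d j - d i) in
  `|b| < 1 -> b = 0 /\ k = 0%N \/ b = x_ k.+1.
Proof.
move=> b; rewrite ltr_norml => /andP[b1 b2].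
have [x0 x1] := hextail01E.
have x2g := hextail_ge R 2; have x2l := hextail_le1 R 2.
(* For k = 0 the outcome 0 is the exact overlap: the indices i = 4 and j = 2 have d_i - d_j = 16 a =
   x_0. *)
case: k @b b1 b2 => [|k].
  case: i => [[|[|[|[|[|//]]]]] ?]; case: j => [[|[|[|[|[|//]]]]] ?];
  rewrite /example_translation /= => b1 b2; first
    [by exfalso; lra | by left; split => //; lra | by right; lra].
have := hextail_recl R k.+1.
(* The bound 4/15 excludes near misses such as i = 4, j = 1 for the digit 15, with outcome x_(k+1) +
   x_0 > 1. *)
have := hextail_ge R k.+2; have := hextail_le1 R k.+2.
case: (hexdigit_pos R k) => -> xl xg xk.
  case: i => [[|[|[|[|[|//]]]]] ?]; case: j => [[|[|[|[|[|//]]]]] ?];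
  rewrite /example_translation /= => b1 b2; first
    [by exfalso; lra | by right; lra].
case: i => [[|[|[|[|[|//]]]]] ?]; case: j => [[|[|[|[|[|//]]]]] ?];
rewrite /example_translation /= => b1 b2; first
  [by exfalso; lra | by right; lra].
Qed.

Lemma zero_step i j : let b := 16 * (d j - d i) in
  `|b| < 1 -> [\/ b = 0, b = x_ 0 | b = - x_ 0].
Proof.
move=> b; rewrite ltr_norml => /andP[b1 b2].
have [x0 x1] := hextail01E.
have x2g := hextail_ge R 2; have x2l := hextail_le1 R 2.
case: i @b b1 b2 => [[|[|[|[|[|//]]]]] ?]; case: j => [[|[|[|[|[|//]]]]] ?];
rewrite /example_translation /= => b1 b2; first
  [by exfalso; lra | by constructor 1; lra | by constructor 2; lra
  | by constructor 3; lra].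
Qed.

Lemma close_translation_step b i j : close_translation b ->
  `|16 * (b + d j - d i)| < 1 -> close_translation (16 * (b + d j - d i)).
Proof.
case=> [->|[k [->|->]]].
- by rewrite add0r => /zero_step[] ->; [left|right; exists 0%N; left|right; exists 0%N; right].
- by move=> /hextail_step[[-> _]|->]; [left|right; exists k.+1; left].
have -> : 16 * (- x_ k + d j - d i) = - (16 * (x_ k + d i - d j)) by ring.
rewrite normrN => /hextail_step[[-> _]|->]; first by left; rewrite oppr0.
by right; exists k.+1; right.
Qed.

Lemma example_translation_bounds i : 0 <= d i <= 15 / 16.
Proof.
have [x0 x1] := hextail01E.
have x2g := hextail_ge R 2; have x2l := hextail_le1 R 2.
case: i => [[|[|[|[|[|//]]]]] ?]; rewrite /example_translation /=;
by apply/andP; split; lra.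
Qed.

(** The induction appends letters, that is, innermost maps, since these act on the relative
    translation by the transitions. *)
Lemma word_map_translation sigma tau : size sigma = size tau ->
  exists b, (1 <= `|b| \/ close_translation b) /\
    forall x, word_map S tau x = word_map S sigma (x + b).
Proof.
elim/last_ind: sigma tau => [|sigma i IH] tau.
  by case: tau => // _; exists 0; split=> [|x]; [right; left|rewrite addr0].
case/lastP: tau => [|tau j]; first by rewrite size_rcons.
rewrite !size_rcons => -[/IH[b [hb eb]]].
exists (16 * (b + d j - d i)); split; last first.
  move=> x; rewrite !word_map_rcons eb !example_mapE; congr (word_map _ _ _).
  by field.
have [|lt1] := leP 1 `|16 * (b + d j - d i)|; first by left.
right; case: hb => [b1|hb]; last exact: close_translation_step.
(* Two translations differ by at most 15/16, and 16 (1 - 15/16) = 1. *)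
exfalso; have := example_translation_bounds i; have := example_translation_bounds j.
move: lt1 b1; rewrite ltr_norml lter_normr => /andP[u v] /orP[w|w] /andP[? ?] /andP[? ?]; lra.
Qed.

Lemma close_translation_ge b : close_translation b -> b != 0 -> 4 / 15 <= `|b|.
Proof.
have P k : `|x_ k| = x_ k by rewrite ger0_norm //; have := hextail_ge R k; lra.
by case=> [->|[k [->|->]]]; rewrite ?eqxx ?normrN ?P // => _; exact: hextail_ge.
Qed.

Lemma example_weak_separation : weak_separation_property S.
Proof.
apply: (@lt_le_trans _ _ (4 / 15 : R)%:E); first by rewrite lte_fin; lra.
apply: le_ereal_inf_tmp => _ [b [[sigma [tau [st e]]] b0] <-].
have [c [hc ec]] := word_map_translation st.
have bc : b = c by have := e 0; rewrite ec word_mapK !add0r.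
rewrite lee_fin bc; case: hc => [|/close_translation_ge]; first by lra.
by apply; rewrite -bc.
Qed.

(** * The finite type condition for the orbit of a window *)

Lemma ifs_map_unit i x : 0 < x < 1 -> 0 < ifs_map S i x < 1.
Proof.
move=> /andP[? ?]; have /andP[? ?] := example_translation_bounds i.
by rewrite example_mapE; apply/andP; split; lra.
Qed.

Lemma word_map_unit sigma x : 0 < x < 1 -> 0 < word_map S sigma x < 1.
Proof. by move=> hx; elim: sigma => //= i sigma; exact: ifs_map_unit. Qed.

(* (3/4, 7/8) meets none of its translates by x_k, nor any of the translates by
   ±x_k of the first level intervals S_i([0, 1]), for k >= 1. *)
Definition orbit_of_window : set R :=
  [set y | exists sigma w, 3 / 4 < w < 7 / 8 /\ y = word_map S sigma w].

Notation V := orbit_of_window.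

Lemma orbit_of_window_unit y : V y -> 0 < y < 1.
Proof.
by move=> [sigma [w [/andP[? ?] ->]]]; apply: word_map_unit; apply/andP; split; lra.
Qed.

Lemma orbit_of_window_stable i : ifs_map S i @` V `<=` V.
Proof. by move=> _ [_ [sigma [w [hw ->]]] <-]; exists (i :: sigma), w. Qed.

Lemma open_orbit_of_window : open V.
Proof.
have -> : V = \bigcup_sigma (word_map_inv S sigma @^-1` `]3 / 4, 7 / 8[%classic).
  apply/seteqP; split => y.
    move=> [sigma [w [hw ->]]]; exists sigma => //=.
    by rewrite word_mapK in_itv.
  move=> [sigma _ /=]; rewrite in_itv /= => hw.
  by exists sigma, (word_map_inv S sigma y); rewrite word_map_invK.
apply: bigcup_open => sigma _; apply: open_comp; last exact: interval_open.
move=> + _; elim: sigma => [|i sigma IH] x /=; first exact: cvg_id.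
apply: (@continuous_comp _ _ _ (ifs_map_inv S i)); last exact: IH.
exact: continuous_ifs_map_inv.
Qed.

(** Subtracting x_(k+1) moves the window into the gap between S_3([0, 1]) and S_4([0, 1]) if the
    digit is 4, and below 0 if it is 15. Adding it moves the window beyond 1, as 3/4 + 4/15 > 1. *)
Lemma window_not_shifted_cylinder k j u w : 0 < u < 1 -> 3 / 4 < w < 7 / 8 ->
  w != ifs_map S j u + x_ k.+1 /\ ifs_map S j u != w + x_ k.+1.
Proof.
move=> /andP[u0 u1] /andP[w0 w1]; rewrite example_mapE.
have [x0 x1] := hextail01E.
have x2g := hextail_ge R 2; have x2l := hextail_le1 R 2.
have := hextail_recl R k.+1.
have := hextail_ge R k.+2; have := hextail_le1 R k.+2.
case: (hexdigit_pos R k) => -> xl xg xk;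
case: j => [[|[|[|[|[|//]]]]] ?]; rewrite /example_translation /=;
by split; apply/eqP => e; lra.
Qed.

(** Removing the outermost letters of both words turns the shift x_(k+1) into x_(k+2), until a word
    is empty and the position of the window decides. If both are empty, the length 1/8 of the window
    is less than 4/15. *)
Lemma orbit_of_window_disjoint k y z : V y -> V z -> y <> z + x_ k.+1.
Proof.
move=> [sigma [w [hw ->]]] [tau [w' [hw' ->]]].
have unit (v : R) : 3 / 4 < v < 7 / 8 -> 0 < v < 1.
  by move=> /andP[? ?]; apply/andP; split; lra.
elim: sigma tau k => [|i sigma IH] [|j tau] k /=.
- by have := hextail_ge R k.+1; case/andP: hw => ? ?; case/andP: hw' => ? ? *; lra.
- by have [/eqP + _] := window_not_shifted_cylinder k j (word_map_unit tau (unit _ hw')) hw.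
- by have [_ /eqP] := window_not_shifted_cylinder k i (word_map_unit sigma (unit _ hw)) hw'.
have us := word_map_unit sigma (unit _ hw); have ut := word_map_unit tau (unit _ hw').
move=> e; move: e us ut (IH tau k.+1).
set u := word_map S sigma w; set v := word_map S tau w'.
rewrite !example_mapE => e /andP[u0 u1] /andP[v0 v1]; apply.
have uv : u = v + 16 * (x_ k.+1 + d j - d i) by lra.
(* The positive index rules out the transition to 0. The modulus is below 1 because [u] and [v] lie
   in (0, 1). *)
suff /hextail_step[[]|<-] : `|16 * (x_ k.+1 + d j - d i)| < 1 by [].
by rewrite ltr_norml; apply/andP; split; lra.
Qed.

Definition translation_by (b : R) : R -> R := fun x => x + b.

Lemma example_finite_type : finite_type_condition S.
Proof.
exists V; split.
- by exists (4 / 5), [::], (4 / 5); split=> //; apply/andP; split; lra.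
- exact: open_orbit_of_window.
- exact: orbit_of_window_stable.
(* A type is determined by which of the translations by 0, x_0 and -x_0 it contains. The triple [B]
   records this, so at most eight types occur. *)
pose T (B : bool * bool * bool) : set (R -> R) :=
  [set f | exists b, f = translation_by b /\
    [\/ B.1.1 /\ b = 0, B.1.2 /\ b = x_ 0 | B.2 /\ b = - x_ 0]].
apply: (@sub_finite_set _ _ (T @` [set: bool * bool * bool])); last first.
  exact/finite_image/finite_finset.
move=> _ [sigma _ <-]; set N := neighbourhood_type _ _ _.
exists (`[< N (translation_by 0) >], `[< N (translation_by (x_ 0)) >],
  `[< N (translation_by (- x_ 0)) >]) => //.
apply/seteqP; split => [f [b [-> /=]]|f Nf].
  by case=> [[/asboolP + ->]|[/asboolP + ->]|[/asboolP + ->]].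
have [tau [st [_ [[u Vu <-] [v Vv e]]]] fE] := Nf.
have [b [hb eb]] := word_map_translation st.
have fb : f = translation_by b by rewrite -fE; apply/funext => x /=; rewrite eb word_mapK.
exists b; split=> //=.
have uv : u = v + b by apply: (@word_map_inj _ _ S sigma); rewrite -eb.
have [/andP[u0 u1] /andP[v0 v1]] := (orbit_of_window_unit Vu, orbit_of_window_unit Vv).
rewrite fb in Nf; case: hb => [|hb].
  by rewrite lter_normr => /orP[] ?; clear st; exfalso; lra.
case: hb fb uv Nf => [->|[[|k] [->|->]]] fb uv Nf.
- by constructor 1; split=> //; apply/asboolP.
- by constructor 2; split=> //; apply/asboolP.
- by constructor 3; split=> //; apply/asboolP.
- by case: (orbit_of_window_disjoint Vu Vv uv).
- by case: (@orbit_of_window_disjoint k _ _ Vv Vu); clear st; lra.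
Qed.

(** * Failure of the convex finite type condition *)

(** S_1 and S_2 realise x_0. Each further digit is realised by appending two letters: S_4 and S_1
    for 11, S_5 and S_1 for 15, S_5 and S_4 for 4. *)
Lemma hextail_neighbour_words k : exists sigma tau, size sigma = size tau /\
  forall x, word_map S tau x = word_map S sigma (x + x_ k).
Proof.
elim: k => [|k [sigma [tau [st e]]]].
  exists [:: inord 0], [:: inord 1]; split=> // x /=.
  by rewrite !example_mapE /example_translation !inordK //=; field.
suff [i [j dij]] : exists i j, d i - d j = hexdigit R k / 16.
  exists (rcons sigma i), (rcons tau j); split; first by rewrite !size_rcons st.
  move=> x; rewrite !word_map_rcons e !example_mapE (hextail_recl R k).
  by congr (word_map _ _ _); lra.
case: k {e} => [|k].
  by exists (inord 3), (inord 0); rewrite /example_translation !inordK //= hexdigit0; lra.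
case: (hexdigit_pos R k) => ->.
  by exists (inord 4), (inord 0); rewrite /example_translation !inordK //=; lra.
by exists (inord 4), (inord 3); rewrite /example_translation !inordK //=; lra.
Qed.

(** Each type is finite, so finitely many types would contain finitely many translations, whereas
    the x_(k+1) are all distinct. *)
Lemma example_not_convex_finite_type : attractor S 0 -> attractor S 1 ->
  ~ convex_finite_type_condition S.
Proof.
move=> K0 K1 [_ _ _ fin].
set U := interior _ in fin.
have UI : `]0, 1[%classic `<=` U by exact: unit_interval_sub_hull.
apply: infinite_nat.
pose translations := [set f 0 | f in
  \bigcup_(A in [set neighbourhood_type S U sigma | sigma in [set: seq 'I_5]]) A].
have : finite_set translations.
  apply: finite_image; apply: bigcup_finite => // _ [sigma _ <-].
  exact: neighbourhood_type_finite.
move=> /(@finite_preimage _ _ _ (fun k => x_ k.+1) (in2W (@hextailS_inj R))).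
apply: sub_finite_set => k _ /=.
have [sigma [tau [st e]]] := hextail_neighbour_words k.+1.
exists (word_map_inv S sigma \o word_map S tau); last by rewrite /= e word_mapK add0r.
exists (neighbourhood_type S U sigma); first by exists sigma.
exists tau => //; split=> //.
have := hextail_lt1 R k; have := hextail_ge R k.+1 => xg xl.
have IU y : 0 < y < 1 -> U y by move=> hy; apply: UI; rewrite /= in_itv.
(* The midpoint of (0, 1 - x_(k+1)) stays in (0, 1) when shifted by x_(k+1). *)
exists (word_map S tau ((1 - x_ k.+1) / 2)); split; last first.
  by exists ((1 - x_ k.+1) / 2) => //; apply: IU; apply/andP; split; lra.
rewrite e; exists ((1 - x_ k.+1) / 2 + x_ k.+1) => //.
by apply: IU; apply/andP; split; lra.
Qed.

(** * Extreme points of the attractor and a gap in it *)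

Lemma example_attractorP :
  [/\ attractor S !=set0, compact (attractor S)
    & attractor S = \bigcup_(i in [set: 'I_5]) (ifs_map S i @` attractor S)].
Proof.
apply: (@attractorP _ _ _ 0 1).
  move=> i x /andP[? ?]; have /andP[? ?] := example_translation_bounds i.
  by rewrite example_mapE; apply/andP; split; lra.
exists (inord 0), 0; rewrite example_mapE /example_translation inordK //=.
by split; [apply/andP; split|]; lra.
Qed.

Lemma attractor_map i x : attractor S x -> attractor S (ifs_map S i x).
Proof.
by have [_ _ e] := example_attractorP => Kx; rewrite e; exists i => //; exists x.
Qed.

Lemma attractor_preimage y : attractor S y -> exists i x, attractor S x /\ y = ifs_map S i x.
Proof.
by have [_ _ {1}->] := example_attractorP; move=> [i _ [x Kx <-]]; exists i, x.
Qed.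

Lemma closed_attractor : closed (attractor S).
Proof. by have [_ cK _] := example_attractorP; exact: compact_closed (@Rhausdorff R) cK. Qed.

(** The maximum m of the attractor is an image point, so m <= m/16 + 15/16. Conversely S_5(m) <= m,
    whence m = 1. *)
Lemma attractor_max : attractor S 1 /\ forall x, attractor S x -> x <= 1.
Proof.
have [K0 cK _] := example_attractorP.
have [m Km maxm] : exists2 m, attractor S m & forall x, attractor S x -> x <= m.
  have [|m] := @compact_EVT_max _ _ idfun _ K0 cK.
    by apply: continuous_subspaceT => x; exact: cvg_id.
  by rewrite inE => Km h; exists m => // x Kx; apply: h; rewrite inE.
have m1 : m <= 1.
  have [i [x [/maxm xm mE]]] := attractor_preimage Km.
  have /andP[_ di] := example_translation_bounds i.
  by move: mE; rewrite example_mapE; lra.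
have e : m = 1.
  have := maxm _ (attractor_map (inord 4) Km).
  by rewrite example_mapE /example_translation inordK //=; lra.
by rewrite e in Km maxm; split.
Qed.

Lemma attractor_min : attractor S 0 /\ forall x, attractor S x -> 0 <= x.
Proof.
have [K0 cK _] := example_attractorP.
have [m Km minm] : exists2 m, attractor S m & forall x, attractor S x -> m <= x.
  have [|m] := @compact_EVT_min _ _ idfun _ K0 cK.
    by apply: continuous_subspaceT => x; exact: cvg_id.
  by rewrite inE => Km h; exists m => // x Kx; apply: h; rewrite inE.
have m0 : 0 <= m.
  have [i [x [/minm xm mE]]] := attractor_preimage Km.
  have /andP[di _] := example_translation_bounds i.
  by move: mE; rewrite example_mapE; lra.
have e : m = 0.
  have := minm _ (attractor_map (inord 0) Km).
  by rewrite example_mapE /example_translation inordK //=; lra.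
by rewrite e in Km minm; split.
Qed.

Lemma attractor_unit x : attractor S x -> 0 <= x <= 1.
Proof. by move=> Kx; rewrite (proj2 attractor_min) // (proj2 attractor_max). Qed.

(** The point 1/2 lies in the gap between S_3([0, 1]) and S_4([0, 1]). *)
Lemma half_notin_attractor : ~ attractor S (1 / 2).
Proof.
move=> /attractor_preimage[i [x [/attractor_unit/andP[x0 x1]]]].
rewrite example_mapE => e; have [h0 h1] := hextail01E.
have x2g := hextail_ge R 2; have x2l := hextail_le1 R 2.
move: e; case: i => [[|[|[|[|[|//]]]]] ?]; rewrite /example_translation /=; lra.
Qed.

(** * Upper bound for the dimension by cylinder covers *)

Lemma word_map_dist sigma x y :
  `|word_map S sigma x - word_map S sigma y| = (1 / 16) ^+ size sigma * `|x - y|.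
Proof.
elim: sigma => [|i sigma IH] /=; first by rewrite expr0 mul1r.
rewrite exprS -mulrA -IH !example_mapE.
set u := word_map _ _ x; set v := word_map _ _ y.
have -> : u / 16 + d i - (v / 16 + d i) = 1 / 16 * (u - v) by lra.
by rewrite normrM ger0_norm //; lra.
Qed.

Lemma attractor_word m x : attractor S x -> exists sigma y,
  [/\ size sigma = m, attractor S y & x = word_map S sigma y].
Proof.
elim: m x => [|m IH] x Kx; first by exists [::], x.
have [i [y [/IH[sigma [z [<- Kz ->]]] ->]]] := attractor_preimage Kx.
by exists (i :: sigma), z.
Qed.

Lemma cylinder_cover m : exists U : nat -> set R,
  attractor S `<=` \bigcup_(k in `I_(5 ^ m)%N) U k /\
  forall k, (diameter (U k) <= ((1 / 16) ^+ m)%:E)%E.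
Proof.
pose words := [seq tval t | t <- enum {: m.-tuple 'I_5}].
have size_words : size words = (5 ^ m)%N by rewrite size_map -cardE card_tuple card_ord.
exists (fun k => if (k < 5 ^ m)%N then
  word_map S (nth [::] words k) @` `[0, 1]%classic else set0); split.
  move=> x /(attractor_word m)[sigma [y [sm Ky ->]]].
  have sw : sigma \in words.
    by apply/mapP; exists (tcast sm (in_tuple sigma)); [rewrite mem_enum | rewrite val_tcast].
  have lt : (index sigma words < 5 ^ m)%N by rewrite -size_words index_mem.
  exists (index sigma words) => //=; rewrite lt nth_index //; exists y => //.
  by rewrite /= in_itv /= attractor_unit.
move=> k; case: ifP => [km|_]; last by rewrite diameter_set0 leNye.
apply: ge_ereal_sup => _ [_ [x hx <-] [_ [y hy <-] <-]].
have /mapP[t _ ->] : nth [::] words k \in words by rewrite mem_nth // size_words.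
rewrite lee_fin word_map_dist size_tuple -[leRHS]mulr1.
apply: ler_wpM2l; first by apply: exprn_ge0; lra.
move: hx hy; rewrite /= !in_itv /= ler_norml => /andP[? ?] /andP[? ?].
by apply/andP; split; lra.
Qed.

Lemma attractor_dimension_lt1 : (hausdorff_dimension (attractor S) < 1)%E.
Proof.
(* For s = 3/4 the five maps give 5 / 16^(3/4) = 5/8 < 1. *)
apply: (@le_lt_trans _ _ (3 / 4 : R)%:E); last by rewrite lte_fin; lra.
apply: (@hausdorff_dimension_le _ _ (1 / 16) _ 5).
- by lra.
- by apply/andP; split; lra.
- have -> : 1 / 16 = (1 / 2 : R) `^ 4%:R by rewrite powR_mulrn; lra.
  rewrite -powRrM; have -> : 4 * (3 / 4) = 3%:R :> R by lra.
  by rewrite powR_mulrn; lra.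
- exact: cylinder_cover.
Qed.

(** * Lower bound for the dimension from the addresses in S_1 and S_5 *)

(** The digits 0 and 15 stand for S_1 and S_5. Points of the closed attractor with m prescribed
    letters approach the expansion from below. *)
Lemma expansion_in_attractor (c : nat -> R) : (forall n, c n = 0 \/ c n = 15) ->
  attractor S (expansion c).
Proof.
have bounds (b : nat -> R) : (forall n, b n = 0 \/ b n = 15) ->
    forall n, 0 <= b n <= 15.
  by move=> h n; case: (h n) => ->; apply/andP; split; lra.
have approx m : forall b : nat -> R, (forall n, b n = 0 \/ b n = 15) -> exists p,
    attractor S p /\ expansion b - (1 / 16) ^+ m <= p <= expansion b.
  elim: m => [|m IH] b hb.
    exists 0; split; first exact: (proj1 attractor_min).
    have /andP[] := expansion_bounds (lexx _) (lexx _) (bounds _ hb).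
    by move=> *; rewrite expr0; apply/andP; split; lra.
  have [p [Kp /andP[p1 p2]]] := IH (digit_shift b 1) (fun n => hb _).
  rewrite (expansion_recl (bounds _ hb)) exprS.
  case: (hb 0%N) => ->.
    exists (ifs_map S (inord 0) p); split; first exact: attractor_map.
    by rewrite example_mapE /example_translation inordK //=; apply/andP; split; lra.
  exists (ifs_map S (inord 4) p); split; first exact: attractor_map.
  by rewrite example_mapE /example_translation inordK //=; apply/andP; split; lra.
move=> hc; have /choice[p hp] := fun m => approx m c hc.
apply: (closed_cvg _ closed_attractor (u_ := p) (F := \oo)).
  by apply: nearW => m; exact: (proj1 (hp m)).
apply: (@squeeze_cvgr _ _ _ _ (fun m => expansion c - (1 / 16) ^+ m) (fun=> expansion c)).
- by apply: nearW => m; exact: (proj2 (hp m)).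
- rewrite -[X in _ --> X]subr0; apply: cvgB; first exact: cvg_cst.
  by apply: cvg_expr; rewrite ger0_norm; lra.
- exact: cvg_cst.
Qed.

(* Binary digits of y, reread as hexadecimal digits 0 and 15: these are the
   addresses using only S_1 and S_5. *)
Definition doubling (y : R) : R := if 1 / 2 <= y then 2 * y - 1 else 2 * y.

Definition binary_digit15 (y : R) (n : nat) : R :=
  if 1 / 2 <= iter n doubling y then 15 else 0.

Definition binary_to_hex (y : R) : R := expansion (binary_digit15 y).

Lemma binary_digit15P y n : binary_digit15 y n = 0 \/ binary_digit15 y n = 15.
Proof. by rewrite /binary_digit15; case: ifP; [right|left]. Qed.

Lemma doubling_unit y : 0 <= y <= 1 -> 0 <= doubling y <= 1.
Proof.
by move=> /andP[? ?]; rewrite /doubling; case: (leP (1 / 2) y) => ?; apply/andP; split; lra.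
Qed.

Lemma binary_digit15_bounds y n : 0 <= binary_digit15 y n <= 15.
Proof. by case: (binary_digit15P y n) => ->; apply/andP; split; lra. Qed.

Lemma binary_to_hex_recl y : binary_to_hex y =
  ((if 1 / 2 <= y then 15 else 0) + binary_to_hex (doubling y)) / 16.
Proof.
rewrite /binary_to_hex (expansion_recl (binary_digit15_bounds y)).
congr ((_ + expansion _) / _); apply/funext => n.
by rewrite /digit_shift /binary_digit15 add1n iterSr.
Qed.

Lemma binary_to_hex_unit y : 0 <= binary_to_hex y <= 1.
Proof.
have /andP[] := expansion_bounds (lexx _) (lexx _) (binary_digit15_bounds y).
by rewrite -/(binary_to_hex y) => *; apply/andP; split; lra.
Qed.

(** Since 16 = 2^4, equal leading binary digits scale both sides by 1/16. Different ones put the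
    images at least 14/16 apart, and twice this exceeds 1. *)
Lemma binary_to_hex_holder y z : 0 <= y <= 1 -> 0 <= z <= 1 ->
  `|y - z| ^+ 4 <= 2 * `|binary_to_hex y - binary_to_hex z|.
Proof.
(* The error 16^(-n) makes n = 0 trivial and allows an induction on the number of digits
   compared. *)
move=> hy hz; apply: (@le_add_geometric _ _ _ 1) => n.
elim: n y z hy hz => [|n IH] y z hy hz.
  rewrite mulr1 ler_wpDl // ?mulr_ge0 // exprn_ile1 // ler_norml.
  by case/andP: hy => ? ?; case/andP: hz => ? ?; apply/andP; split; lra.
have far u v : 0 <= u <= 1 -> 0 <= v <= 1 ->
    `|y - z| ^+ 4 <= 2 * `|(15 + u) / 16 - (0 + v) / 16| + 1 * (1 / 16) ^+ n.+1.
  move: hy hz => /andP[? ?] /andP[? ?] /andP[? ?] /andP[? ?].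
  have : 0 <= (1 / 16) ^+ n.+1 :> R by apply: exprn_ge0; lra.
  move=> ?; apply: (@le_trans _ _ 1).
    by rewrite exprn_ile1 // ler_norml; apply/andP; split; lra.
  by rewrite ger0_norm; lra.
have half4 (t : R) : `|t / 2| ^+ 4 = `|t| ^+ 4 / 16.
  by rewrite normrM exprMn (@ger0_norm _ 2^-1) ?invr_ge0 //; congr (_ * _); field.
have := IH _ _ (doubling_unit hy) (doubling_unit hz).
have gy := binary_to_hex_unit (doubling y); have gz := binary_to_hex_unit (doubling z).
rewrite (binary_to_hex_recl y) (binary_to_hex_recl z).
move: gy gz; set u := binary_to_hex (doubling y); set v := binary_to_hex (doubling z).
move=> gy gz.
have same e : `|(e + u) / 16 - (e + v) / 16| = `|u - v| / 16.
  have -> : (e + u) / 16 - (e + v) / 16 = (u - v) / 16 by lra.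
  by rewrite normrM (@ger0_norm _ 16^-1) // invr_ge0.
rewrite /doubling; case: (leP (1 / 2) y) => _; case: (leP (1 / 2) z) => _.
- have -> : y - z = (2 * y - 1 - (2 * z - 1)) / 2 by lra.
  by rewrite half4 same (exprS _ n); lra.
- by move=> _; exact: far.
- by move=> _; rewrite (distrC ((0 + u) / 16)); exact: far.
- have -> : y - z = (2 * y - 2 * z) / 2 by lra.
  by rewrite half4 same (exprS _ n); lra.
Qed.

Lemma attractor_dimension_gt0 : (0 < hausdorff_dimension (attractor S))%E.
Proof.
apply: (@lt_le_trans _ _ (4%:R^-1 : R)%:E); first by rewrite lte_fin invr_gt0.
apply: (@hausdorff_dimension_ge _ _ binary_to_hex 3 2) => //.
  by move=> y _; apply: expansion_in_attractor; exact: binary_digit15P.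
exact: binary_to_hex_holder.
Qed.

(** * Distinct maps, the exact overlap and failure of the open set condition *)

Lemma example_distinct i j : i != j -> ifs_map S i <> ifs_map S j.
Proof.
move=> ij /(congr1 (@^~ 0)); rewrite !example_mapE => e.
have [x0 x1] := hextail01E.
have x2g := hextail_ge R 2; have x2l := hextail_le1 R 2.
by move: ij e; case: i => [[|[|[|[|[|//]]]]] ?]; case: j => [[|[|[|[|[|//]]]]] ?] //;
  rewrite /example_translation /= => _ e; exfalso; lra.
Qed.

Lemma example_overlap : ifs_map S (inord 0) \o ifs_map S (inord 4) =
  ifs_map S (inord 1) \o ifs_map S (inord 2).
Proof.
apply/funext => x /=.
by rewrite !example_mapE /example_translation !inordK //=; field.
Qed.

Lemma example_not_open_set_condition_for V : ~ open_set_condition_for S V.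
Proof.
apply: overlap_not_open_set_condition_for example_overlap.
by rewrite -val_eqE /= !inordK.
Qed.

End Counterexample.

Theorem mainTheorem2 (R : realType) :
  exists a : R,
    let S := example_ifs a in
    let K := attractor S in
    [/\ [/\ K 0, K 1, K `<=` `[0, 1]%classic, K <> `[0, 1]%classic
          & (0 < hausdorff_dimension K < 1)%E],
        (forall i j : 'I_5, i != j -> ifs_map S i <> ifs_map S j) /\
        ifs_map S (inord 0) \o ifs_map S (inord 4) =
          ifs_map S (inord 1) \o ifs_map S (inord 2),
        weak_separation_property S /\ finite_type_condition S
      & [/\ ~ open_set_condition S, ~ convex_open_set_condition S
          & ~ convex_finite_type_condition S]].
Proof.
exists (hextail R 0 / 16) => S K.
have [K0 _] := attractor_min R; have [K1 _] := attractor_max R.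
split.
- split=> //.
  + by move=> x /attractor_unit; rewrite /= in_itv.
  + move=> Kunit; apply: (@half_notin_attractor R); rewrite -/S -/K Kunit /= in_itv /=.
    by apply/andP; split; lra.
  + by rewrite attractor_dimension_gt0 attractor_dimension_lt1.
- by split; [exact: example_distinct | exact: example_overlap].
- by split; [exact: example_weak_separation | exact: example_finite_type].
- split.
  + by case=> V; exact: example_not_open_set_condition_for.
  + exact: example_not_open_set_condition_for.
  + exact: example_not_convex_finite_type.
Qed.
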